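(* Let $R$ be a ring with identity and let $F$ be a parametrization of a cochain complex of free $R$-modules of finite rank over a finite graded poset $(X,\leq)$. Run the algorithm Scythe (described in the context) on $F$. Then the collection $\Sigma$ of those pairs $(x,y)\in X\times X$ for which the subroutine ReducePair$(x,y)$ is invoked by Scythe constitutes an $F$-compatible acyclic matching on (the input poset) $(X,\leq)$.
   Context: $R$ is a fixed coefficient ring with identity. In a poset, $x\prec y$ ($y$ covers $x$) means $x<y$ and there is no $z$ with $x<z<y$. A poset $(X,\le)$ is graded if $X=\bigsqcup_{n\in\mathbb N}X_n$ (elements of $X_n$ have dimension $n$) such that $x\prec y$ implies $\dim y=\dim x+1$. Write $x_+=\{y: x\prec y\}$ and $y_-=\{x: x\prec y\}$. A parametrization $F$ of a cochain complex $(C^\bullet,d^\bullet)$ over $(X,\le)$ assigns to each $x\in X$ an $R$-module $F(x)$ and to each covering relation $x\prec y$ a linear map $F_{xy}:F(x)\to F(y)$ (with $F_{xy}=0$ by convention when $x\not\prec y$), such that $C^n=\bigoplus_{x\in X_n}F(x)$ and the block of $d^n$ from $F(x)$ to $F(y)$ is $F_{xy}$. A partial matching on $X$ is a set $\Sigma\subset X\times X$ of pairs $(x,y)$ with $x\prec y$ such that no element of $X$ lies in more than one pair. It is acyclic if the transitive closure of the relation $(x,y)\lhd(x',y')\iff x\prec y'$ on $\Sigma$ is a partial order. An acyclic matching is $F$-compatible if $F_{xy}$ is invertible for all $(x,y)\in\Sigma$. Subroutine ReducePair$(x^\star,y^\star)$ (for $x^\star\prec y^\star$ with $F_{x^\star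 y^\star}$ invertible): for each $z\in x^\star_+\setminus\{y^\star\}$ and each $w\in y^\star_-\setminus\{x^\star\}$, set $w\prec z$ and replace $F_{wz}$ by $F_{wz}-F_{x^\star z}\circ F_{x^\star y^\star}^{-1}\circ F_{wy^\star}$; then remove $x^\star$ and $y^\star$ from $X$. Algorithm Scythe (modifies $X$ and $F$ in place; initially no element is marked critical; the sets $x_\pm$, $y_\pm$ refer to the current poset): 1. While $X$ has elements not marked critical: 2. select a minimal element $c$ among the non-critical elements of $X$ and mark it critical; 3. set the queue Que to be empty and enqueue $c$; 4. while Que is nonempty: dequeue $y$; if $y_-$ contains exactly one non-critical element $x$, and $F_{xy}$ is invertible, then enqueue $x_+\setminus\{y\}$ and call ReducePair$(x,y)$; in any case, then enqueue (the elements of) $y_+$ (as it was before a possible removal of $y$). Queue conventions: an element that has been enqueued is flagged and cannot be enqueued again until Que is reinitialized in step 3 (when all flags are cleared); apart from the element $c$ just selected, no critical elements are enqueued; elements removed from $X$ are disregarded. *)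

(* Defs.v *)
From HB Require Import structures.
From mathcomp Require Import all_boot all_order all_algebra.
From Stdlib Require Relation_Definitions Relation_Operators.

Set Implicit Arguments.
Unset Strict Implicit.
Unset Printing Implicit Defensive.

Import Order.TTheory GRing.Theory.
Local Open Scope ring_scope.

Section Modules.
Variable R : pzRingType.

(* The library's vectType requires a nontrivial ring; this is its axiom,
   stated over an arbitrary ring. *)
Definition free_of_finite_rank (V : lmodType R) : Prop :=
  exists (n : nat) (f : {linear V -> 'rV[R]_n}), bijective f.

Definition inverse_maps (U V : lmodType R) (f : {linear U -> V})
  (g : {linear V -> U}) : Prop := cancel f g /\ cancel g f.

Definition invertible (U V : lmodType R) (f : {linear U -> V}) : Prop :=
  exists g : {linear V -> U}, inverse_maps f g.

Record cochain_complex := CochainComplex {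
  cochain :> nat -> lmodType R;
  coboundary : forall n, {linear cochain n -> cochain n.+1};
  coboundaryK : forall n u, coboundary n.+1 (coboundary n u) = 0
}.

End Modules.

Definition covers {d} {X : finPOrderType d} (x y : X) : bool :=
  (x < y)%O && [forall z, ~~ ((x < z)%O && (z < y)%O)].

Definition graded {d} (X : finPOrderType d) (dim : X -> nat) : Prop :=
  forall x y : X, covers x y -> dim y = (dim x).+1.

Definition stratum {d} {X : finPOrderType d} (dim : X -> nat) (n : nat) :=
  {x : X | dim x == n}.

(* C n is the direct sum of the F x for dim x = n, via the injections pinj and
   the projections pproj (X is finite). *)
Record parametrization (R : pzRingType) d (X : finPOrderType d)
    (dim : X -> nat) (C : cochain_complex R) := Parametrization {
  pobj :> X -> lmodType R;
  pmor : forall x y, {linear pobj x -> pobj y};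
  pmor_ncovers : forall x y, ~~ covers x y -> forall u, pmor x y u = 0;
  pinj : forall n (x : stratum dim n), {linear pobj (val x) -> C n};
  pproj : forall n (x : stratum dim n), {linear C n -> pobj (val x)};
  pinjK : forall n (x : stratum dim n), cancel (@pinj n x) (@pproj n x);
  pinj_neq : forall n (x y : stratum dim n) u, x != y ->
    @pproj n y (@pinj n x u) = 0;
  psum : forall n (v : C n),
    \sum_(x : stratum dim n) @pinj n x (@pproj n x v) = v;
  pblock : forall n (x : stratum dim n) (y : stratum dim n.+1) u,
    @pproj n.+1 y (@coboundary R C n (@pinj n x u)) = pmor (val x) (val y) u
}.

Section Matchings.
Context {d : Order.disp_t} {X : finPOrderType d}.
Implicit Types (x y z : X) (Sigma : {set X * X}).

Definition partial_matching Sigma : Prop :=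
  (forall x y, (x, y) \in Sigma -> covers x y) /\
  (forall p q z, p \in Sigma -> q \in Sigma ->
     z \in [set p.1; p.2] -> z \in [set q.1; q.2] -> p = q).

Definition precedes Sigma (p q : {p | p \in Sigma}) : Prop :=
  covers (val p).1 (val q).2.

(* clos_trans is the transitive closure and order is "reflexive, transitive
   and antisymmetric". *)
Definition acyclic_matching Sigma : Prop :=
  partial_matching Sigma /\
  Relation_Definitions.order {p | p \in Sigma}
    (Relation_Operators.clos_trans {p | p \in Sigma} (@precedes Sigma)).

Definition compatible_acyclic_matching (R : pzRingType) (dim : X -> nat)
    (C : cochain_complex R) (F : parametrization dim C) Sigma : Prop :=
  acyclic_matching Sigma /\
  (forall x y, (x, y) \in Sigma -> invertible (pmor F x y)).

End Matchings.

Section Scythe.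
Variables (R : pzRingType) (X : finType) (F : X -> lmodType R).
Implicit Types (x y z w c : X) (s : seq X) (A : {set X}).

(* The modules F x never change: only the current poset, given by its elements
   and its covering relation, and the maps do. [reduced] records the pairs on
   which ReducePair has been called. *)
Record state := State {
  elts : {set X};
  cov : rel X;
  maps : forall x y, {linear F x -> F y};
  critical : {set X};
  queue : seq X;
  flagged : {set X};
  reduced : {set X * X}
}.
Implicit Types st : state.

Definition upper st x : {set X} := [set y in elts st | cov st x y].
Definition lower st y : {set X} := [set x in elts st | cov st x y].

Definition noncritical st : {set X} := elts st :\: critical st.

(* The order of the current poset is the one generated by its covering
   relation, i.e., its reflexive transitive closure. *)
Definition cur_le st : rel X :=
  connect [rel x y | [&& x \in elts st, y \in elts st & cov st x y]].

Definition minimal_noncritical st c : Prop :=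
  c \in noncritical st /\
  (forall x, x \in noncritical st -> cur_le st x c -> x = c).

Definition select st c : state :=
  State (elts st) (cov st) (@maps st) (c |: critical st) [:: c] [set c]
    (reduced st).

Definition dequeue st : state :=
  State (elts st) (cov st) (@maps st) (critical st) (behead (queue st))
    (flagged st) (reduced st).

(* The elements of a set may be enqueued in any order. *)
Definition enqueue st A st' : Prop :=
  exists s, [/\ uniq s,
    s =i (A :&: noncritical st) :\: flagged st &
    st' = State (elts st) (cov st) (@maps st) (critical st) (queue st ++ s)
            (flagged st :|: [set z in s]) (reduced st)].

Definition affected st x y w z : bool :=
  (w \in (lower st y) :\ x) && (z \in (upper st x) :\ y).

(* g is meant to be the inverse of maps st x y. *)
Definition reduce_maps st x y (g : {linear F y -> F x}) w z :
    {linear F w -> F z} :=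
  if affected st x y w z
  then (maps st w z \- (maps st x z \o (g \o maps st w y)) : {linear _ -> _})
  else maps st w z.

Definition reduce_pair st x y (g : {linear F y -> F x}) : state :=
  State (elts st :\: [set x; y])
    (fun w z => cov st w z || affected st x y w z)
    (@reduce_maps st x y g)
    (critical st) (queue st) (flagged st) ((x, y) |: reduced st).

Definition reducible st x y : Prop :=
  lower st y :&: noncritical st = [set x] /\ invertible (maps st x y).

(* One iteration of the inner loop, once y has been dequeued. *)
Inductive visit st y : state -> Prop :=
| VisitRemoved : y \notin elts st -> visit st y st
| VisitReduce x (g : {linear F y -> F x}) st1 st2 :
    y \in elts st -> reducible st x y -> inverse_maps (maps st x y) g ->
    enqueue st ((upper st x) :\ y) st1 ->
    enqueue (reduce_pair st1 g) (upper st y) st2 ->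
    visit st y st2
| VisitSkip st1 :
    y \in elts st -> (forall x, ~ reducible st x y) ->
    enqueue st (upper st y) st1 ->
    visit st y st1.

Inductive inner_loop st : state -> Prop :=
| InnerDone : queue st = [::] -> inner_loop st st
| InnerStep y s st1 st2 :
    queue st = y :: s -> visit (dequeue st) y st1 -> inner_loop st1 st2 ->
    inner_loop st st2.

Inductive outer_loop st : state -> Prop :=
| OuterDone : noncritical st = set0 -> outer_loop st st
| OuterStep c st1 st2 :
    minimal_noncritical st c -> inner_loop (select st c) st1 ->
    outer_loop st1 st2 -> outer_loop st st2.

End Scythe.

Definition initial_state (R : pzRingType) d (X : finPOrderType d)
    (dim : X -> nat) (C : cochain_complex R) (F : parametrization dim C) :
    state F :=
  State setT covers (@pmor _ _ _ _ _ F) set0 [::] set0 set0.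

(* Scythe leaves some choices open (the minimal element c, the order in which
   sets are enqueued): Sigma is the collection of pairs on which ReducePair is
   invoked in some complete execution. *)
Definition scythe_pairs (R : pzRingType) d (X : finPOrderType d)
    (dim : X -> nat) (C : cochain_complex R) (F : parametrization dim C)
    (Sigma : {set X * X}) : Prop :=
  exists2 st, outer_loop (initial_state F) st & reduced st = Sigma.

(* Main.v *)
(** Once [x] is the only noncritical element below [y], ReducePair(x, y) creates
    new covers and changes maps only out of critical elements. So the covers and
    maps out of a noncritical element are always the original ones, which makes
    each reduced pair an original cover with an invertible original map.
    Moreover, after ReducePair(x, y) no remaining noncritical element lies below
    [y] in the input poset, while the lower element of a later pair is
    noncritical until its removal: the relation between pairs can only go from
    an earlier pair to a later one, hence it has no cycle. *)
Require Import Defs.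
From mathcomp Require Import all_boot all_order all_algebra.

Set Implicit Arguments.
Unset Strict Implicit.
Unset Printing Implicit Defensive.

(** Each matched pair precedes itself because its own elements form a cover, which gives
    reflexivity. Every other step raises [r], so a chain leading back to its start must be constant,
    which gives antisymmetry. *)
Lemma acyclic_matching_rank (d : Order.disp_t) (X : finPOrderType d)
    (Sigma : {set X * X}) (r : X * X -> nat) :
  partial_matching Sigma ->
  (forall p q, p \in Sigma -> q \in Sigma -> covers p.1 q.2 -> p <> q ->
     r p < r q) ->
  acyclic_matching Sigma.
Proof.
move=> match_Sigma r_lt; split=> //.
have rank_le p q :
    Relation_Operators.clos_trans _ (@precedes d X Sigma) p q ->
    p = q \/ r (val p) < r (val q).
  elim=> {p q} [p q cov_pq | p q s _ IHpq _ IHqs].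
    have [/val_inj-> | /eqP neq_pq] := eqVneq (val p) (val q); first by left.
    by right; apply: r_lt => //; apply: valP.
  case: IHpq => [-> // | lt_pq]; case: IHqs => [<- | lt_qs]; right=> //.
  exact: ltn_trans lt_pq lt_qs.
split.
- move=> [[x y] Sxy]; apply: Relation_Operators.t_step.
  exact: match_Sigma.1 Sxy.
- by move=> p q s; apply: Relation_Operators.t_trans.
- move=> p q /rank_le[// | lt_pq] /rank_le[// | lt_qp].
  by have := ltn_trans lt_pq lt_qp; rewrite ltnn.
Qed.

Section Invariant.
Variables (R : pzRingType) (d : Order.disp_t) (X : finPOrderType d).
Variables (dim : X -> nat) (C : cochain_complex R) (F : parametrization dim C).
Implicit Types (x y z w : X) (st : state F).

(** [covers] and [pmor F] are the input data, [cov] and [maps] the current ones. As [reduced] is a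
    set and forgets the order of the reductions, [inv_rank] keeps that order as a rank. *)
Record invariant st : Prop := Invariant {
  inv_cov : forall x y, x \in noncritical st -> cov st x y = covers x y;
  inv_maps : forall x y, x \in noncritical st -> maps st x y = pmor F x y;
  inv_removed : forall p, p \in reduced st -> [disjoint [set p.1; p.2] & elts st];
  inv_below : forall x p, p \in reduced st -> x \in noncritical st ->
    ~~ covers x p.2;
  inv_matching : partial_matching (reduced st);
  inv_invertible : forall x y, (x, y) \in reduced st -> invertible (pmor F x y);
  inv_rank : exists r : X * X -> nat, forall p q,
    p \in reduced st -> q \in reduced st -> covers p.1 q.2 -> p <> q -> r p < r q
}.

Lemma invariant_initial : invariant (initial_state F).
Proof.
split=> //= [p | x p | | x y |]; rewrite ?inE //.
- by split=> [x y | p q z]; rewrite inE.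
- by exists (fun=> 0) => p q; rewrite inE.
Qed.

Lemma invariant_queue st qu fl :
  invariant st ->
  invariant (State (elts st) (cov st) (@maps _ _ _ st) (critical st) qu fl
               (reduced st)).
Proof. by case. Qed.

Lemma invariant_enqueue st A st' :
  enqueue st A st' -> invariant st -> invariant st'.
Proof. by case=> s [_ _ ->]; apply: invariant_queue. Qed.

(** Marking [c] critical only shrinks the noncritical set over which the clauses quantify. *)
Lemma invariant_select st c : invariant st -> invariant (select st c).
Proof.
have sub x : x \in noncritical (select st c) -> x \in noncritical st.
  by rewrite !inE negb_or => /andP[/andP[_ ->] ->].
case=> Icov Imaps Irem Ibel Imat Iinv Irk.
split=> //= [x y /sub | x y /sub | x p Sp /sub]; auto.
Qed.

Section ReducePair.
Variables (st : state F) (x y : X) (g : {linear F y -> F x}).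
Hypotheses (invst : invariant st) (y_elts : y \in elts st).
Hypothesis red_xy : reducible st x y.

Let below_y w : w \in noncritical st -> cov st w y -> w = x.
Proof.
move=> Nw cov_wy; apply/set1P; rewrite -red_xy.1 inE Nw andbT inE cov_wy andbT.
by move: Nw; rewrite inE => /andP[].
Qed.

Let x_lower : x \in noncritical st /\ cov st x y.
Proof.
have : x \in lower st y :&: noncritical st by rewrite red_xy.1 set11.
by rewrite inE => /andP[]; rewrite inE => /andP[].
Qed.

Let x_elts : x \in elts st.
Proof. by case: x_lower; rewrite inE => /andP[]. Qed.

Let noncritical_reduce w :
  w \in noncritical (reduce_pair st g) -> w \in noncritical st /\ w != x.
Proof.
by rewrite !inE negb_or => /andP[-> /andP[/andP[-> _] ->]].
Qed.

(** The update touches only sources [w] below [y] other than [x], and reducibility makes all of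
    these critical. *)
Let noncritical_unaffected w z :
  w \in noncritical st -> affected st x y w z = false.
Proof.
move=> Nw; apply/negP => /andP[/setD1P[/eqP neq_wx]].
by rewrite inE => /andP[_ /(below_y Nw)].
Qed.

(** Earlier pairs have left the poset, whereas [x] and [y] are still in it. *)
Let fresh p z : p \in reduced st -> z \in [set p.1; p.2] ->
  z \in [set x; y] -> False.
Proof.
move=> Sp pz; suff /disjointFr-> : [disjoint [set p.1; p.2] & [set x; y]] by [].
apply: disjointWr (inv_removed invst Sp).
by apply/subsetP=> t /set2P[] ->.
Qed.

Lemma invariant_reduce : invariant (reduce_pair st g).
Proof.
have [Nx cov_xy] := x_lower.
have covers_xy : covers x y by rewrite -(inv_cov invst).
split=> /=.
- move=> w z /noncritical_reduce[Nw _].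
  by rewrite noncritical_unaffected // orbF (inv_cov invst).
- move=> w z /noncritical_reduce[Nw _].
  by rewrite /reduce_maps noncritical_unaffected // (inv_maps invst).
- move=> p /setU1P[-> | Sp] /=.
    by rewrite disjoint_sym disjoints_subset setDE subsetIr.
  by apply: disjointWr (inv_removed invst Sp); apply: subsetDl.
- move=> w p Sp /noncritical_reduce[Nw neq_wx].
  case/setU1P: Sp => [-> /= | Sp]; last exact: (inv_below invst).
  (* An input cover of [y] by a noncritical [w] is still a current one, which forces [w] to be the
     removed [x]. *)
  rewrite -(inv_cov invst) //; apply: contraNN neq_wx => cov_wy.
  exact/eqP/below_y.
- split=> [w z /setU1P[[-> ->] // | Sp] | p q z].
    exact: (inv_matching invst).1 Sp.
  case/setU1P=> [-> | Sp] /setU1P[-> // | Sq] pz qz.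
  + by case: (fresh Sq qz pz).
  + by case: (fresh Sp pz qz).
  + exact: (inv_matching invst).2 Sp Sq pz qz.
- move=> w z /setU1P[[-> ->] | Sp]; last exact: (inv_invertible invst).
  by rewrite -(inv_maps invst) //; apply: red_xy.2.
- have [r r_lt] := inv_rank invst.
  (* The new pair is ranked above all earlier ones, whose ranks are kept. *)
  exists (fun p => if p == (x, y) then (\max_(q in reduced st) r q).+1 else r p).
  have old p : p \in reduced st -> (p == (x, y)) = false.
    move=> Sp; apply/eqP=> def_p; apply: (@fresh p x) => //.
      by rewrite def_p !inE eqxx.
    by rewrite !inE eqxx.
  move=> p q /setU1P[-> | Sp] /setU1P[-> | Sq] //= cov_pq neq_pq.
  (* The new pair cannot precede an earlier one: [x] was noncritical until now. *)
  + by case/negP: (inv_below invst Sq Nx).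
  + by rewrite eqxx old // ltnS (bigD1 p) //= leq_maxl.
  + by rewrite !old //; apply: r_lt.
Qed.

End ReducePair.

Lemma invariant_visit st y st' : visit st y st' -> invariant st -> invariant st'.
Proof.
case=> [// | x g st1 st2 y_elts red_xy _ enq1 enq2 invst | st1 _ _ enq1].
  (* Exposing [st1] as [st] with another queue and flags lets the hypotheses on [st] apply to it by
     conversion. *)
  apply: (invariant_enqueue enq2); case: enq1 => s [_ _ ->].
  by apply: invariant_reduce => //; apply: invariant_queue.
exact: invariant_enqueue enq1.
Qed.

Lemma invariant_inner_loop st st' :
  inner_loop st st' -> invariant st -> invariant st'.
Proof.
elim=> {st st'} // st y s st1 st2 _ visit_y _ IH invst; apply: IH.
by apply: (invariant_visit visit_y); apply: invariant_queue.
Qed.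

Lemma invariant_outer_loop st st' :
  outer_loop st st' -> invariant st -> invariant st'.
Proof.
elim=> {st st'} // st c st1 st2 _ inner _ IH invst; apply: IH.
by apply: (invariant_inner_loop inner); apply: invariant_select.
Qed.

End Invariant.

Theorem proposition4p2 (R : pzRingType) (d : Order.disp_t)
    (X : finPOrderType d) (dim : X -> nat) (hX : graded dim)
    (C : cochain_complex R) (hC : forall n : nat, free_of_finite_rank (C n))
    (F : parametrization dim C) (Sigma : {set X * X}) :
  scythe_pairs F Sigma -> compatible_acyclic_matching F Sigma.
Proof.
case=> st run <-; have invst := invariant_outer_loop run (invariant_initial F).
have [r r_lt] := inv_rank invst.
split; first exact: acyclic_matching_rank (inv_matching invst) r_lt.
exact: inv_invertible invst.
Qed.
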